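(* Let $G$ and $H$ be embedded graphs, with medial graphs $G_m$ and $H_m$. Then there is the following hierarchy of graph equivalences and notions of duality: 1. $G_m$ and $H_m$ are equivalent as embedded graphs if and only if $G$ and $H$ are geometric duals; 2. $G_m$ and $H_m$ are equivalent as locally embedded maps (or are partial Petrials) if and only if $G$ and $H$ are partial duals; 3. $G_m$ and $H_m$ are equivalent as abstract graphs if and only if $G$ and $H$ are twisted duals. Furthermore, 4. $G_m$ and $H_m$ (with their canonical checkerboard colourings) are equivalent under $C3$ moves if and only if $G$ and $H$ are partial trialities; 5. $G_m$ and $H_m$ (with their canonical checkerboard colourings) are equivalent under $C4$ moves if and only if $G$ and $H$ are partial Wilsonials.
   Context: Embedded graphs. An embedded graph is a finite graph (loops and multiple edges allowed) cellularly embedded in a closed, possibly disconnected and possibly non-orientable, surface. Equivalently, it is a ribbon graph: a surface with boundary that is a union of vertex discs and edge discs, meeting in disjoint line segments, each segment on the boundary of exactly one vertex disc and one edge disc, each edge disc containing exactly two segments. Equivalently, it is an arrow presentation: a set of circles with disjoint labelled arrows on them, each label appearing on exactly two arrows, up to relabelling pairs and reversing both arrows of a given label. Circles correspond to vertex discs; for each label $e$ an edge disc is attached by orienting its boundary, choosing two disjoint boundary arcs directed accordingly, and identifying these with the two $e$-labelled arrows respecting directions. ''Equivalent as embedded graphs'' (written $=$) means isomorphic: there is a homeomorphism preserving the vertex-edge structure. ''Equivalent as abstract graphs'' means that the underlying abstract graphs are isomorphic. Geometric duals. The geometric dual $G^*$ of a cellularly embedded graph $G$ has a vertex in each face of $G$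 and, for each edge of $G$, an edge joining the vertices of the faces that share that edge on their boundaries. In item 1, ''$G$ and $H$ are geometric duals'' is understood as $H\in\{G,G^*\}$. Locally embedded maps. Choosing an orientation of a neighbourhood of each vertex of an embedded graph gives a cyclic order of the half-edges at each vertex, and so an underlying combinatorial map. Two embedded graphs are equivalent as locally embedded maps if the local orientations at their vertices can be chosen so that the resulting combinatorial maps are equal (isomorphic). Twisted duality. For an edge $e$ of $G$ (given as an arrow presentation): $G^{\tau(e)}$ is obtained by reversing exactly one of the two $e$-labelled arrows; $G^{\delta(e)}$ is obtained as follows: if $A,B$ are the two $e$-labelled arrows, add a segment with an $e$-labelled arrow directed from the head of $A$ to the tail of $B$, and a segment with an $e$-labelled arrow directed from the head of $B$ to the tail of $A$, and delete $A$ and $B$ together with the arcs containing them. On each edge $\tau^2=\delta^2=(\tau\delta)^3=1$; operations on different edges commute; words act by $G^{\xi\zeta(e)}=(G^{\zeta(e)})^{\xi(e)}$; so $\mathfrak{G}=\langle\delta,\tau\mid\delta^2,\tau^2,(\tau\delta)^3\rangle\cong S_3$ acts at each edge. $G$ and $H$ are twisted duals if $H$ is obtained from $G$ by applying some element of $\mathfrak{G}$ at each edge; they are partial duals, partial Petrials, partial trialities, partial Wilsonials if the elements applied can all be taken in the subgroup generated by $\delta$, $\tau$, $\delta\tau$, $\tau\delta\tau=\delta\tau\delta$ respectively. Medial graphs. The medial graph $G_m$ of a cellularly embedded graph $G$ is the 4-regular embedded graph in the same surface with a vertex $v_e$ of degree 4 on each edge $e$ of $G$ and edges drawn by following the face boundaries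 of $G$. An isolated vertex of $G$ gives by convention an isolated face in $G_m$. The canonical checkerboard colouring of $G_m$ colours black the faces containing vertices of $G$ and white the other faces. $C$ moves. Let $F$ be a checkerboard coloured 4-regular embedded graph. At each vertex $v$ there are three pairings of the four half-edges: the black pairing $B_v$ (half-edges adjacent at a common black corner of $v$), the white pairing $W_v$ (adjacent at a common white corner), and the crossing pairing $X_v$ (opposite half-edges). Conversely, the abstract graph together with the choice of $B_v,W_v$ at each vertex determines the checkerboard coloured embedded graph (black faces are discs attached along the closed trails given by the pairings $B_v$, white faces along those given by $W_v$). A $Ci$ move at $v$ leaves the abstract graph and the pairings at all other vertices unchanged and replaces $(W_v,B_v,X_v)$ as follows: the two $C3$ moves (types $C3a$ and $C3b$, corresponding to applying $\tau\delta$ and $\delta\tau$ to the edge of the black-face graph at $v$) are the two cyclic permutations of $(W_v,B_v,X_v)$; the $C4$ move (corresponding to $\delta\tau\delta$) exchanges $B_v$ and $X_v$ and fixes $W_v$. Two checkerboard coloured graphs are equivalent under $C3$ (resp. $C4$) moves if they are related, up to colour preserving isomorphism, by a finite sequence of such moves.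
   Formalization: Item 1 fails for disconnected G; its equivalence is stated for connected G, and for all G with H obtained by taking geometric duals of some connected components. Equivalences of medial graphs must also match the number of isolated faces. *)

(* Defs.v *)
(* Embedded graphs are encoded as arrow presentations.  The two arrows with
   label [e] are [(e, true)] and [(e, false)], and each arrow has a head and a
   tail.  Removing the arrows from the circles leaves arcs, each joining two
   arrow ends, so the circles carrying arrows amount to a fixed-point-free
   involution on the set of arrow ends.  Circles without arrows are the
   isolated vertices; only their number matters. *)
From mathcomp Require Import all_boot all_fingroup.

Set Implicit Arguments.
Unset Strict Implicit.
Unset Printing Implicit Defensive.

Definition arrow (E : finType) : finType := (E * bool)%type.

(* [(a, true)] is the head of the arrow [a] and [(a, false)] its tail. *)
Definition arrow_end (E : finType) : finType := (arrow E * bool)%type.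

Definition mate (E : finType) (a : arrow E) : arrow E := (a.1, ~~ a.2).

Definition flip (E : finType) (x : arrow_end E) : arrow_end E := (x.1, ~~ x.2).

(* The boundary of the edge disc of a label with arrows A, B consists of A, of
   a side from the head of A to the tail of B, of B, and of a side from the
   head of B to the tail of A; [side] exchanges the two ends of a side. *)
Definition side (E : finType) (x : arrow_end E) : arrow_end E :=
  (mate x.1, ~~ x.2).

Record embedded_graph := EmbeddedGraph {
  edge : finType;
  circle_arc : arrow_end edge -> arrow_end edge;
  circle_arcK : involutive circle_arc;
  circle_arc_neq : forall x, circle_arc x != x;
  isolated_vertices : nat
}.

(* Equivalence of embedded graphs: [fe] relabels the edges, [s e] tells whether
   the two [e]-labelled arrows are interchanged, and [r e] whether both are
   reversed. *)
Definition relabel_end (E E' : finType) (fe : E -> E') (s r : E -> bool)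
    (x : arrow_end E) : arrow_end E' :=
  (fe x.1.1, x.1.2 (+) s x.1.1, x.2 (+) r x.1.1).

Definition is_embedded_iso (G H : embedded_graph)
    (fe : edge G -> edge H) (s r : edge G -> bool) : Prop :=
  bijective fe /\
  forall x, relabel_end fe s r (circle_arc x)
            = circle_arc (relabel_end fe s r x).

Definition embedded_equiv (G H : embedded_graph) : Prop :=
  isolated_vertices G = isolated_vertices H /\
  exists (fe : edge G -> edge H) (s r : edge G -> bool),
    is_embedded_iso fe s r.

(* The circles and the faces are the components of these two relations. *)
Definition circle_step (G : embedded_graph) : rel (arrow_end (edge G)) :=
  [rel x y | (y == flip x) || (y == circle_arc x)].

Definition face_step (G : embedded_graph) : rel (arrow_end (edge G)) :=
  [rel x y | (y == side x) || (y == circle_arc x)].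

Definition circle (G : embedded_graph) (x : arrow_end (edge G)) :
    {set arrow_end (edge G)} :=
  [set y | connect (@circle_step G) x y].

Record multigraph := Multigraph {
  mg_vertex : finType;
  mg_edge : finType;
  mg_ends : mg_edge -> bool -> mg_vertex  (* the two ends, in arbitrary order *)
}.

Definition multigraph_iso (K L : multigraph) : Prop :=
  exists (fv : mg_vertex K -> mg_vertex L) (fe : mg_edge K -> mg_edge L)
         (s : mg_edge K -> bool),
    [/\ bijective fv, bijective fe
      & forall e b, mg_ends (fe e) (b (+) s e) = fv (mg_ends e b)].

Definition nonisolated_vertex (G : embedded_graph) : finType :=
  {C : {set arrow_end (edge G)} | [exists x, C == circle x]}.

Lemma circle_subproof (G : embedded_graph) (x : arrow_end (edge G)) :
  [exists y, circle x == circle y].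
Proof. by apply/existsP; exists x. Qed.

Definition vertex_at (G : embedded_graph) (a : arrow (edge G)) :
    nonisolated_vertex G :=
  exist _ (circle (a, true)) (circle_subproof (a, true)).

Definition abstract_graph (G : embedded_graph) : multigraph :=
  @Multigraph (nonisolated_vertex G + 'I_(isolated_vertices G))%type (edge G)
    (fun e b => inl (vertex_at (e, b))).

Definition abstract_equiv (G H : embedded_graph) : Prop :=
  multigraph_iso (abstract_graph G) (abstract_graph H).

(* Arrows play the role of half-edges.  A choice of an orientation of every
   circle is recorded by the set [out] of the arrow ends at which one leaves an
   arrow when running along its circle in the chosen direction. *)
Definition local_orientation (G : embedded_graph)
    (out : arrow_end (edge G) -> bool) : Prop :=
  forall x, out (flip x) = ~~ out x /\ out (circle_arc x) = ~~ out x.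

(* The end of [a] lying in [out] is [(a, out (a, true))]. *)
Definition rotation (G : embedded_graph) (out : arrow_end (edge G) -> bool)
    (a : arrow (edge G)) : arrow (edge G) :=
  (circle_arc (a, out (a, true))).1.

Definition locally_embedded_equiv (G H : embedded_graph) : Prop :=
  isolated_vertices G = isolated_vertices H /\
  exists (oG : arrow_end (edge G) -> bool) (oH : arrow_end (edge H) -> bool)
         (f : arrow (edge G) -> arrow (edge H)),
    [/\ local_orientation oG, local_orientation oH, bijective f,
        forall a, f (mate a) = mate (f a)
      & forall a, f (rotation oG a) = rotation oH (f a)].

(* Moves every point [x] to the place [p x] without changing the arcs. *)
Section Rearrange.
Variables (G : embedded_graph) (p : {perm arrow_end (edge G)}).

Definition rearranged_arc (x : arrow_end (edge G)) : arrow_end (edge G) :=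
  p (circle_arc ((p^-1)%g x)).

Lemma rearranged_arcK : involutive rearranged_arc.
Proof.
by move=> x; rewrite /rearranged_arc permK circle_arcK permKV.
Qed.

Lemma rearranged_arc_neq x : rearranged_arc x != x.
Proof.
rewrite /rearranged_arc -{2}(permKV p x) (inj_eq perm_inj).
exact: circle_arc_neq.
Qed.

Definition rearrange : embedded_graph :=
  EmbeddedGraph rearranged_arcK rearranged_arc_neq (isolated_vertices G).

End Rearrange.

Inductive twist_gen := Delta | Tau.

(* Words in the generators, acting as in [G^(xi zeta) = (G^zeta)^xi]: the last
   letter acts first. *)
Definition twist_word := seq twist_gen.

(* Reverses the arrow indexed by [true]. *)
Definition tau_fun (p : bool * bool) : bool * bool := (p.1, p.1 (+) p.2).

(* With A, B the arrows indexed by [true], [false], the new arrow [true] runs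
   from the head of A to the tail of B, and the new arrow [false] from the head
   of B to the tail of A. *)
Definition delta_fun (p : bool * bool) : bool * bool :=
  if p.2 then (p.1, false) else (~~ p.1, true).

Lemma tau_inj : injective tau_fun.
Proof. by case=> [[] []] [[] []]. Qed.

Lemma delta_inj : injective delta_fun.
Proof. by case=> [[] []] [[] []]. Qed.

Definition gen_act (g : twist_gen) : {perm bool * bool} :=
  match g with Delta => perm delta_inj | Tau => perm tau_inj end.

Definition word_act (w : twist_word) : {perm bool * bool} :=
  foldr (fun g p => p * gen_act g)%g 1%g w.

Definition twist_fun (E : finType) (w : E -> twist_word) (x : arrow_end E) :
    arrow_end E :=
  let p := word_act (w x.1.1) (x.1.2, x.2) in (x.1.1, p.1, p.2).

Lemma twist_inj (E : finType) (w : E -> twist_word) : injective (twist_fun w).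
Proof.
move=> [[e i] h] [[e' i'] h'] [<-] /= e1 e2.
have /perm_inj[-> ->] // :
  word_act (w e) (i, h) = word_act (w e) (i', h').
by apply: injective_projections.
Qed.

(* [twist G w] applies [w e] at every edge [e]; operations on different edges
   commute, so they can be performed simultaneously. *)
Definition twist (G : embedded_graph) (w : edge G -> twist_word) :
    embedded_graph :=
  rearrange (perm (@twist_inj (edge G) w)).

Definition twisted_duals (G H : embedded_graph) : Prop :=
  exists w : edge G -> twist_word, embedded_equiv (twist w) H.

(* The elements applied lie in the subgroup generated by [g]; as every element
   has finite order, nonnegative powers are enough. *)
Definition twisted_duals_in (g : twist_word) (G H : embedded_graph) : Prop :=
  exists w : edge G -> twist_word,
    (forall e, exists k, w e = flatten (nseq k g)) /\
    embedded_equiv (twist w) H.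

Definition partial_duals := twisted_duals_in [:: Delta].
Definition partial_petrials := twisted_duals_in [:: Tau].
Definition partial_trialities := twisted_duals_in [:: Delta; Tau].
Definition partial_wilsonials := twisted_duals_in [:: Tau; Delta; Tau].

(* The dual has the faces as circles.  The edge discs are kept, but are now
   attached along their sides: the dual arrow [(e, i)] is the side directed
   from the head of [(e, i)] to the tail of [(e, ~~ i)].  [dual_place A] sends
   an end of a dual arrow to the point of [G] where it lies, for the edges in
   [A], and leaves the ends of the other arrows in place. *)
Definition dual_place (E : finType) (A : {set E}) (x : arrow_end E) :
    arrow_end E :=
  if x.1.1 \in A then
    if x.2 then (x.1.1, ~~ x.1.2, false) else (x.1, true)
  else x.

Lemma dual_place_inj (E : finType) (A : {set E}) : injective (dual_place A).
Proof.
have labelE x : (dual_place A x).1.1 = x.1.1.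
  by rewrite /dual_place; case: ifP => // _; case: ifP.
move=> [[e i] h] [[e' i'] h'] eq.
have /= ee := congr1 (fun x => x.1.1) eq; rewrite !labelE /= in ee; subst e'.
move: eq; rewrite /dual_place /=; case: ifP => // _.
by case: h h' i i' => [] [] [] [].
Qed.

Definition dual_on (G : embedded_graph) (A : {set edge G}) : embedded_graph :=
  rearrange ((perm (@dual_place_inj (edge G) A))^-1)%g.

Definition geometric_dual (G : embedded_graph) : embedded_graph :=
  dual_on [set: edge G].

Definition geometric_duals (G H : embedded_graph) : Prop :=
  embedded_equiv G H \/ embedded_equiv (geometric_dual G) H.

(* [A] is the edge set of a union of connected components of [G]; an isolated
   vertex is its own dual.  Dualising some components of a disconnected graph
   and not the others does not change the medial graph either. *)
Definition union_of_components (G : embedded_graph) (A : {set edge G}) : Prop :=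
  forall x : arrow_end (edge G), ((circle_arc x).1.1 \in A) = (x.1.1 \in A).

Definition componentwise_geometric_duals (G H : embedded_graph) : Prop :=
  exists2 A : {set edge G}, union_of_components A & embedded_equiv (dual_on A) H.

Definition component_step (G : embedded_graph) : rel (arrow_end (edge G)) :=
  [rel x y | (x.1.1 == y.1.1) || (y == circle_arc x)].

(* At most one component: the empty graph is included. *)
Definition connected_graph (G : embedded_graph) : Prop :=
  n_comp (@component_step G) (arrow_end (edge G)) + isolated_vertices G <= 1.

(* Medial graphs may have isolated faces, which carry no vertex and no edge;
   every equivalence takes them into account. *)
Record faced_graph := FacedGraph {
  fg_graph :> embedded_graph;
  isolated_faces : nat
}.

Definition faced (R : embedded_graph -> embedded_graph -> Prop)
    (M N : faced_graph) : Prop :=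
  R M N /\ isolated_faces M = isolated_faces N.

Section Medial.
Variable G : embedded_graph.

(* The edges of the medial graph are the arcs of [G]; its half-edges at [v_e]
   are the ends of the two [e]-labelled arrows.  An arc is represented by its
   end of smaller rank. *)
Definition medial_edge : finType :=
  {x : arrow_end (edge G) | enum_rank x < enum_rank (circle_arc x)}.

Definition medial_half (a : arrow medial_edge) : arrow_end (edge G) :=
  if a.2 then val a.1 else circle_arc (val a.1).

(* Each side of a medial edge runs either along a vertex of [G] (black) or
   inside a face of [G] (white).  The medial arrows are directed so that the
   arrow [(m, true)] goes from black to white, [(m, false)] from white to
   black. *)
Definition medial_black (y : arrow_end medial_edge) : bool := y.1.2 (+) y.2.

Definition medial_split (y : arrow_end medial_edge) :
    arrow_end (edge G) * bool :=
  (medial_half y.1, medial_black y).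

Lemma medial_rep_subproof (x : arrow_end (edge G)) :
  let r := if enum_rank x < enum_rank (circle_arc x) then x
           else circle_arc x in
  enum_rank r < enum_rank (circle_arc r).
Proof.
rewrite /=; case: ifP => // /negbT; rewrite -leqNgt circle_arcK leq_eqVlt.
case/orP => // /eqP/val_inj/enum_rank_inj exy.
by case/eqP: (circle_arc_neq x).
Qed.

Definition medial_rep (x : arrow_end (edge G)) : medial_edge :=
  exist (fun x => enum_rank x < enum_rank (circle_arc x)) _
    (medial_rep_subproof x).

Definition medial_unsplit (z : arrow_end (edge G) * bool) :
    arrow_end medial_edge :=
  let m := medial_rep z.1 in
  let b := val m == z.1 in
  (m, b, b (+) z.2).

Lemma medial_unsplitK : cancel medial_unsplit medial_split.
Proof.
case=> x c; rewrite /medial_split /medial_black /medial_half /= addKb.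
congr (_, _); case: (ifP (enum_rank x < _)) => _; first by rewrite eqxx.
by rewrite (negbTE (circle_arc_neq x)) circle_arcK.
Qed.

Lemma medial_splitK : cancel medial_split medial_unsplit.
Proof.
case=> [[m b] h].
have mE : medial_rep (medial_half (m, b)) = m.
  apply: val_inj; rewrite /= /medial_half /=; case: b => /=.
    by rewrite (valP m).
  by rewrite circle_arcK ltnNge ltnW ?(valP m).
have bE : (val m == medial_half (m, b)) = b.
  rewrite /medial_half; case: (b) => /=; first exact: eqxx.
  by rewrite eq_sym (negbTE (circle_arc_neq _)).
rewrite /medial_unsplit -[(medial_split _).1]/(medial_half (m, b)) mE bE.
by rewrite /= /medial_black /= addKb.
Qed.

(* At [v_e], a black corner lies between the two ends of an arrow of [G], a
   white corner between the two ends of a side of its edge disc. *)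
Definition medial_corner (z : arrow_end (edge G) * bool) :
    arrow_end (edge G) * bool :=
  (if z.2 then flip z.1 else side z.1, z.2).

Definition medial_arc (y : arrow_end medial_edge) : arrow_end medial_edge :=
  medial_unsplit (medial_corner (medial_split y)).

Lemma medial_cornerK : involutive medial_corner.
Proof.
by case=> [[[e i] h] []]; rewrite /medial_corner /flip /side /mate /= !negbK.
Qed.

Lemma medial_arcK : involutive medial_arc.
Proof.
by move=> y; rewrite /medial_arc medial_unsplitK medial_cornerK medial_splitK.
Qed.

Lemma medial_arc_neq y : medial_arc y != y.
Proof.
apply/eqP => /(congr1 medial_split); rewrite /medial_arc medial_unsplitK.
case: (medial_split y) => [[[e i] h] []] [];
  rewrite /= ?(rwP eqP) ?negb_eqb; by case: h.
Qed.

Definition medial : faced_graph :=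
  FacedGraph (EmbeddedGraph medial_arcK medial_arc_neq 0) (isolated_vertices G).

End Medial.

Definition same_vertex (G : embedded_graph) : rel (arrow (edge G)) :=
  [rel a b | connect (@circle_step G) (a, true) (b, true)].

Definition four_regular (G : embedded_graph) : Prop :=
  isolated_vertices G = 0 /\
  forall a : arrow (edge G), #|[set b | same_vertex a b]| = 4.

(* [colour x] is the colour ([true] for black) of the face whose boundary runs
   through the arrow end [x]; the faces on the two sides of an edge have
   different colours. *)
Record coloured_graph := ColouredGraph {
  cg_graph :> faced_graph;
  colour : arrow_end (edge cg_graph) -> bool;
  isolated_face_colour : 'I_(isolated_faces cg_graph) -> bool;
  colour_face : forall x y, connect (@face_step cg_graph) x y ->
                  colour y = colour x;
  colour_checkerboard : forall x, colour (flip x) = ~~ colour x;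
  coloured_four_regular : four_regular cg_graph
}.

Definition same_isolated_faces (F F' : coloured_graph) : Prop :=
  exists2 g : 'I_(isolated_faces F) -> 'I_(isolated_faces F'),
    bijective g & forall i, isolated_face_colour (g i) = isolated_face_colour i.

Definition coloured_iso (F F' : coloured_graph) : Prop :=
  same_isolated_faces F F' /\
  isolated_vertices F = isolated_vertices F' /\
  exists (fe : edge F -> edge F') (s r : edge F -> bool),
    is_embedded_iso fe s r /\
    forall x, colour (relabel_end fe s r x) = colour x.

(* [corner_pairing true] is the black pairing, [corner_pairing false] the white
   one: the corner next to the half-edge [a] with colour [c] is the arc at the
   end of [a] coloured [c]. *)
Definition corner_pairing (c : bool) (F : coloured_graph)
    (a : arrow (edge F)) : arrow (edge F) :=
  (circle_arc (a, colour (a, true) == c)).1.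

Definition black_pairing := corner_pairing true.
Definition white_pairing := corner_pairing false.

(* The opposite half-edge is two corners further. *)
Definition crossing_pairing (F : coloured_graph) (a : arrow (edge F)) :
    arrow (edge F) :=
  white_pairing (black_pairing a).

Definition pairings (F : coloured_graph) (a : arrow (edge F)) :
    arrow (edge F) * arrow (edge F) * arrow (edge F) :=
  (white_pairing a, black_pairing a, crossing_pairing a).

(* [F'] results from [F] by replacing the triple (W, B, X) by [change (W, B, X)]
   at the vertex of [v]; [f] identifies the half-edges of the two graphs. *)
Definition vertex_move (change : forall T : Type, T * T * T -> T * T * T)
    (F F' : coloured_graph) : Prop :=
  same_isolated_faces F F' /\
  exists (v : arrow (edge F)) (f : arrow (edge F) -> arrow (edge F')),
    [/\ bijective f,
        forall a, f (mate a) = mate (f a),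
        forall a b, same_vertex (f a) (f b) = same_vertex a b
      & forall a, pairings (f a) =
          let: (w, b, x) :=
            if same_vertex v a then change _ (pairings a) else pairings a in
          (f w, f b, f x)].

Definition cycle_left (T : Type) (t : T * T * T) : T * T * T :=
  let: (w, b, x) := t in (b, x, w).
Definition cycle_right (T : Type) (t : T * T * T) : T * T * T :=
  let: (w, b, x) := t in (x, w, b).
Definition exchange_black_crossing (T : Type) (t : T * T * T) : T * T * T :=
  let: (w, b, x) := t in (w, x, b).

Definition C3_move (F F' : coloured_graph) : Prop :=
  vertex_move cycle_left F F' \/ vertex_move cycle_right F F'.

Definition C4_move (F F' : coloured_graph) : Prop :=
  vertex_move exchange_black_crossing F F'.

Inductive equiv_under (move : coloured_graph -> coloured_graph -> Prop) :
    coloured_graph -> coloured_graph -> Prop :=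
| EquivIso F F' : coloured_iso F F' -> equiv_under move F F'
| EquivStep F F' F'' :
    move F F' -> equiv_under move F' F'' -> equiv_under move F F''.

Section CanonicalColouring.
Variable G : embedded_graph.

Lemma medial_colour_face (x y : arrow_end (edge (medial G))) :
  connect (@face_step (medial G)) x y -> medial_black y = medial_black x.
Proof.
case/connectP=> p; elim: p x => [x _ -> //|z p IHp x] /= /andP[xz zp] ey.
rewrite (IHp z zp ey); case/orP: xz => /eqP ->.
  by rewrite /medial_black /side /mate /= addNb addbN negbK.
rewrite -[RHS]/(medial_split x).2 -[LHS]/(medial_split (medial_arc x)).2.
by rewrite /medial_arc medial_unsplitK.
Qed.

Lemma medial_colour_checkerboard (x : arrow_end (edge (medial G))) :
  medial_black (flip x) = ~~ medial_black x.
Proof. by rewrite /medial_black /flip /= addbN. Qed.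

Lemma medial_connectE (x y : arrow_end (edge (medial G))) :
  connect (@circle_step (medial G)) x y
  = ((medial_split x).1.1.1 == (medial_split y).1.1.1).
Proof.
have flipE z : medial_split (@flip (medial_edge G) z)
  = ((medial_split z).1, ~~ (medial_split z).2).
  by rewrite /medial_split /medial_black /flip /= addbN.
have arcE z : medial_split (@circle_arc (medial G) z)
  = medial_corner (medial_split z) by apply: medial_unsplitK.
apply/idP/eqP => [/connectP[p]|].
  elim: p x => [x _ -> //|z p IHp x] /= /andP[xz zp] ey.
  rewrite -(IHp z zp ey); case/orP: xz => /eqP ->.
    by rewrite [medial_split (flip _)]flipE.
  rewrite [in RHS](arcE x).
  rewrite -[medial_half x.1]/(medial_split x).1.
  by case: (medial_split x) => [[[e i] h] []].
have stepf z : connect (@circle_step (medial G)) z (flip z).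
  by apply: connect1; apply/orP; left.
have stepa z : connect (@circle_step (medial G)) z (circle_arc z).
  by apply: connect1; apply/orP; right.
have to (z : arrow_end (edge G) * bool) :
    (connect (@circle_step (medial G)) x (medial_unsplit z) ->
     connect (@circle_step (medial G)) x (medial_unsplit (z.1, ~~ z.2))) *
    (connect (@circle_step (medial G)) x (medial_unsplit z) ->
     connect (@circle_step (medial G)) x (medial_unsplit (medial_corner z))).
  split=> xz; apply: (connect_trans xz).
    have -> : medial_unsplit (z.1, ~~ z.2) = flip (medial_unsplit z).
      by apply: (can_inj (@medial_splitK G)); rewrite flipE !medial_unsplitK.
    exact: stepf.
  have -> : medial_unsplit (medial_corner z)
      = @circle_arc (medial G) (medial_unsplit z).
    by rewrite /= /medial_arc medial_unsplitK.
  exact: stepa.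
have x0 : connect (@circle_step (medial G)) x (medial_unsplit (medial_split x)).
  by rewrite medial_splitK.
rewrite -{2}[y]medial_splitK.
case: (medial_split y) => [[[e i] h] c]; move: x0.
case: (medial_split x) => [[[e' i'] h'] c'] /= x0 ee; subst e'.
have fc z c1 : connect (@circle_step (medial G)) x (medial_unsplit (z, ~~ c1)) ->
    connect (@circle_step (medial G)) x (medial_unsplit (z, c1)).
  by move=> /(to _).1 /=; rewrite negbK.
have all_c z c1 c2 : connect (@circle_step (medial G)) x (medial_unsplit (z, c1)) ->
    connect (@circle_step (medial G)) x (medial_unsplit (z, c2)).
  case: (eqVneq c1 c2) => [-> //|ne xz]; apply: fc.
  by case: c1 c2 ne xz => [] [].
have all_h z c1 c2 h2 : connect (@circle_step (medial G)) x (medial_unsplit (z, c1)) ->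
    connect (@circle_step (medial G)) x (medial_unsplit ((z.1, h2), c2)).
  case: (eqVneq z.2 h2) => [<-|ne] xz; first by apply: (all_c _ c1); case: (z) xz.
  apply: (all_c _ true); have := (to (z, true)).2 (all_c _ _ _ xz).
  by rewrite /medial_corner /flip /=; case: z h2 ne {xz} => a [] [].
case: (eqVneq i i') => [->|ne]; first exact: (all_h (e, i', h') c' c h x0).
have := (to ((e, i', h'), false)).2 (all_c _ _ _ x0).
rewrite /medial_corner /side /mate /= => /(all_h _ _ c h) /=.
by case: i i' ne {x0} => [] [].
Qed.

Lemma medial_four_regular : four_regular (medial G).
Proof.
split=> // a.
pose half (b : arrow (edge (medial G))) := medial_half b.
have half_inj : injective half.
  move=> [m b] [m' b'] hh.
  have : medial_split (m, b, b) = medial_split (m', b', b').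
    by rewrite /medial_split /medial_black /= !addbb -/(half _) hh.
  by move/(can_inj (@medial_splitK G)) => [-> ->].
have svE b : same_vertex a b = ((half a).1.1 == (half b).1.1).
  exact: (medial_connectE (a, true) (b, true)).
rewrite -(card_imset _ half_inj).
have -> : half @: [set b | same_vertex a b] =
    [set ((half a).1.1, z.1, z.2) | z : bool * bool].
  apply/setP => x; apply/imsetP/imsetP.
    case=> b; rewrite inE svE => /eqP ab ->.
    exists ((half b).1.2, (half b).2) => //=.
    by rewrite ab; case: (half b) => [[]].
  case=> z _ ->.
  pose y := medial_unsplit ((half a).1.1, z.1, z.2, true).
  have yE : half y.1 = ((half a).1.1, z.1, z.2).
    by rewrite -[LHS]/(medial_split y).1 medial_unsplitK.
  by exists y.1; rewrite ?inE ?svE yE.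
rewrite card_imset ?cardsT ?card_prod ?card_bool //.
by move=> [i h] [i' h'] [-> ->].
Qed.

Definition canonical_medial : coloured_graph :=
  @ColouredGraph (medial G) (@medial_black G) (fun=> true)
    medial_colour_face medial_colour_checkerboard medial_four_regular.

End CanonicalColouring.

(* Main.v *)
Require Import Defs.
From mathcomp Require Import all_boot all_fingroup.

Set Implicit Arguments.
Unset Strict Implicit.
Unset Printing Implicit Defensive.

(** The half-edges of the medial graph of G at the vertex v_e are the four ends
    of the e-labelled arrows of G, and the edges of the medial graph are the
    arcs of G.  On these four points the Klein four-group acts simply
    transitively: [flip] is the black pairing, [side] the white pairing and
    their product [opposite] the crossing pairing.  Hence the whole theorem
    compares the possible compatibilities of one kind of object, a bijection
    phi between the arrow ends of G and those of H that commutes with the arcs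
    ([arc_iso]), with the three pairings.

    On the side of G and H, a relabelling of arrow presentations is exactly
    such a phi preserving each of the three pairings ([embedded_equivP]).  The
    generator delta, as a permutation of the four points, exchanges the white
    and the black pairing, and tau exchanges the white and the crossing one
    ([twist_realizes]).  So H is the twisted dual of G by w exactly when
    they have equally many isolated vertices and there is a phi which, at each
    edge e, permutes the triple (white, black, crossing) by the word w e
    ([rearrangeP]).  As the permutation of the pairings can be read off at one
    of the four points ([turns_fibre]), each relation of the theorem between G
    and H becomes a pointwise condition on phi.

    It remains to recognise the same conditions on the medial side.
    - An isomorphism of abstract graphs is a phi mapping the vertices v_e to
      vertices.  A bijection between two fibres of four points carries the three
      pairings to the three pairings in some order, and each of the six orders
      is obtained by a word ([turns_exists]): these are all twisted duals.
    - The rotation at v_e of a locally embedded map is a 4-cycle which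
      alternates the black and the white pairing and whose square is the
      crossing pairing; so phi must preserve the crossing pairing, which is what
      the powers of delta do ([medial_locally_embeddedP]).
    - An isomorphism of the embedded medial graphs, up to partial Petrials, acts
      on flags, that is, on pairs of an arrow end and a colour.  It exchanges
      the two colours at some of the vertices, and there phi exchanges the black
      and the white pairing ([medial_descend], [medial_lift]).  The edges of the
      medial graph whose two ends disagree about this exchange are the twisted
      ones.  If none is twisted, then the exchange is constant on each
      component, and H is obtained by dualising some components of G.
    - C3 and C4 moves are by definition permutations of the pairings at a single
      vertex, so they compose to such a phi ([equiv_under_linked]); conversely
      phi is decomposed one edge and one move at a time
      ([equiv_under_canonical]). *)

(** * Pairings and their permutations *)

Definition tmap (T U : Type) (f : T -> U) (t : T * T * T) : U * U * U :=
  let: (w, b, x) := t in (f w, f b, f x).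

Definition opposite (E : finType) (x : arrow_end E) : arrow_end E :=
  side (flip x).

(** In the order (white, black, crossing) of the pairings of medial graphs. *)
Definition corners (E : finType) (x : arrow_end E) :=
  (side x, flip x, opposite x).

Definition gen_change (g : twist_gen) (T : Type) (t : T * T * T) : T * T * T :=
  let: (w, b, x) := t in
  match g with Delta => (b, w, x) | Tau => (x, b, w) end.

(** The permutation of the triple (white, black, crossing) induced by a word;
    it is polymorphic so that it applies both to arrow ends and to half-edges
    of coloured graphs. *)
Definition word_change (u : twist_word) (T : Type) (t : T * T * T) :
    T * T * T :=
  foldr (fun g => @gen_change g T) t u.

(** With psi the pairing at the j-th place of the permuted triple and psi' the
    pairing at the j-th place of the original one, this says that
    psi' (phi x) = phi (psi x): transport along phi permutes the pairings by
    the word u. *)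
Definition turns (E E' : finType) (phi : arrow_end E -> arrow_end E')
    (u : twist_word) (x : arrow_end E) : Prop :=
  corners (phi x) = tmap phi (word_change u (corners x)).

Definition arc_iso (G H : embedded_graph)
    (phi : arrow_end (edge G) -> arrow_end (edge H)) : Prop :=
  bijective phi /\ forall x, phi (circle_arc x) = circle_arc (phi x).

Lemma tmap_comp (T U V : Type) (f : U -> V) (g : T -> U) t :
  tmap f (tmap g t) = tmap (f \o g) t.
Proof. by case: t => [[]]. Qed.

Lemma eq_tmap (T U : Type) (f g : T -> U) : f =1 g -> tmap f =1 tmap g.
Proof. by move=> fg [[a b] c] /=; rewrite !fg. Qed.

Lemma tmap_can (T U : Type) (f : T -> U) g : cancel f g ->
  cancel (tmap f) (tmap g).
Proof. by move=> fK [[a b] c] /=; rewrite !fK. Qed.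

Lemma word_change_tmap u (T U : Type) (f : T -> U) t :
  word_change u (tmap f t) = tmap f (word_change u t).
Proof.
elim: u => //= g u ->; rewrite -/(word_change u t).
by case: (word_change u t) => [[a b] c]; case: g.
Qed.

Lemma word_change_cat u v (T : Type) (t : T * T * T) :
  word_change (u ++ v) t = word_change u (word_change v t).
Proof. exact: foldr_cat. Qed.

Lemma word_change_Delta (b : bool) (T : Type) :
  involutive (@word_change (nseq b Delta) T).
Proof. by case: b => [[[]]|]. Qed.

Lemma word_change_odd g k (T : Type) (t : T * T * T) :
  word_change (flatten (nseq k [:: g])) t = word_change (nseq (odd k) g) t.
Proof.
case: t => [[a b] c].
by elim: k => //= k ->; case: g; case: (odd k).
Qed.

Section KleinGroup.
Variable E : finType.
Implicit Types x y : arrow_end E.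

Lemma flipK : involutive (@flip E).
Proof. by case=> [a h]; rewrite /flip /= negbK. Qed.

Lemma sideK : involutive (@side E).
Proof. by case=> [[e i] h]; rewrite /side /mate /= !negbK. Qed.

Lemma oppositeK : involutive (@opposite E).
Proof. by case=> [[e i] h]; rewrite /opposite /side /flip /mate /= !negbK. Qed.

Lemma side_flip x : side (flip x) = opposite x.
Proof. by []. Qed.

Lemma flip_side x : flip (side x) = opposite x.
Proof. by []. Qed.

Lemma flip_opposite x : flip (opposite x) = side x.
Proof. by rewrite -flip_side flipK. Qed.

Lemma side_opposite x : side (opposite x) = flip x.
Proof. by rewrite -side_flip sideK. Qed.

Lemma opposite_flip x : opposite (flip x) = side x.
Proof. by rewrite -side_flip flipK. Qed.

Lemma opposite_side x : opposite (side x) = flip x.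
Proof. by rewrite -flip_side sideK. Qed.

Definition kleinE :=
  (flipK, sideK, oppositeK, flip_side, side_flip, flip_opposite, side_opposite,
   opposite_flip, opposite_side).

(** The Klein four-group of the pairings acts transitively on the ends that
    share a label. *)
Lemma fibreP x y : x.1.1 = y.1.1 ->
  [\/ y = x, y = side x, y = flip x | y = opposite x].
Proof.
case: x y => [[e i] h] [[e' i'] h'] /= <-.
by case: i i' h h' => [] [] [] []; do [by constructor 1 | by constructor 2
  | by constructor 3 | by constructor 4].
Qed.

Lemma fibre_ind (P : arrow_end E -> Prop) x :
  P x -> P (side x) -> P (flip x) -> P (opposite x) ->
  forall y, x.1.1 = y.1.1 -> P y.
Proof. by move=> Px Ps Pf Po y /fibreP[] ->. Qed.

End KleinGroup.

Section Turning.
Variables E E' : finType.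
Implicit Types phi : arrow_end E -> arrow_end E'.

Lemma turns_nil_fibre phi x y : x.1.1 = y.1.1 ->
  turns phi [::] x -> turns phi [::] y.
Proof.
move=> xy [Es Ef Eo]; move: y xy; apply: fibre_ind; rewrite /turns /corners /=.
- by rewrite Es Ef Eo.
- by rewrite -Es !kleinE -Ef -Eo.
- by rewrite -Ef !kleinE -Es -Eo.
- by rewrite -Eo !kleinE -Es -Ef.
Qed.

Lemma turns_comp (E'' : finType) (psi : arrow_end E' -> arrow_end E'') phi
    u v x :
  turns psi u (phi x) -> turns phi v x -> turns (psi \o phi) (u ++ v) x.
Proof.
by rewrite /turns /= => -> ->; rewrite word_change_tmap tmap_comp
  word_change_cat.
Qed.

(** Dividing by a map that turns by v leaves the part u of the word u ++ v; this
    is how a map out of G becomes a map out of a twist of G. *)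
Lemma turns_uncomp (D : finType) (q : arrow_end E -> arrow_end D) q' phi u v x :
  cancel q q' -> turns q v x -> turns phi (u ++ v) x ->
  turns (phi \o q') u (q x).
Proof.
rewrite /turns /= => qK -> phix; rewrite qK phix.
rewrite word_change_tmap tmap_comp word_change_cat.
by apply: eq_tmap => z /=; rewrite qK.
Qed.

End Turning.

Definition realizes (E : finType) (q : arrow_end E -> arrow_end E)
    (v : E -> twist_word) : Prop :=
  forall x, (q x).1.1 = x.1.1 /\ turns q (v x.1.1) x.

(** One generator acts as the transposition of pairings given by [gen_change],
    by inspection of the four points; for words, the changes compose because
    [word_change] commutes with mapping a function over a triple. *)
Lemma word_act_corners u (p : bool * bool) :
  let bcorners (p : bool * bool) :=
    ((~~ p.1, ~~ p.2), (p.1, ~~ p.2), (~~ p.1, p.2)) in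
  bcorners (word_act u p) = tmap (word_act u) (word_change u (bcorners p)).
Proof.
move=> bc; elim: u => [|g u IHu]; first by rewrite /bc /= !perm1.
have step r : bc (gen_act g r) = tmap (gen_act g) (gen_change g (bc r)).
  by rewrite /bc; case: g; case: r => [[] []] /=; rewrite !permE.
rewrite [word_act _]/(word_act u * gen_act g)%g permM step IHu.
rewrite [word_change (g :: u) _]/(gen_change g (word_change u (bc p))).
case: (word_change u (bc p)) => [[a b] c].
by case: g {step} => /=; rewrite !permM.
Qed.

Lemma twist_realizes (E : finType) (w : E -> twist_word) :
  realizes (twist_fun w) w.
Proof.
case=> [[e i] h]; split=> //; rewrite /turns.
pose place (p : bool * bool) : arrow_end E := (e, p.1, p.2).
have placeE p : twist_fun w (place p) = place (word_act (w e) p).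
  by case: p.
have cornersE p : corners (place p)
    = tmap place ((~~ p.1, ~~ p.2), (p.1, ~~ p.2), (~~ p.1, p.2)).
  by case: p => j k; rewrite /corners /place /= /opposite /side /flip /mate /=
    negbK.
rewrite -[(e, i, h)]/(place (i, h)) placeE !cornersE word_act_corners.
rewrite word_change_tmap !tmap_comp; apply: eq_tmap => p /=.
by rewrite placeE.
Qed.

(** Precomposition with the inverse of a twist reduces every statement about
    turning to the case of the empty word. *)
Lemma turns_factor (E E' : finType) (phi : arrow_end E -> arrow_end E') u x :
  turns phi u x ->
  exists theta, [/\ turns theta [::] (twist_fun (fun=> u) x)
                  & phi =1 theta \o twist_fun (fun=> u)].
Proof.
pose q := twist_fun (fun _ : E => u).
have [q' qK q'K] := injF_bij (@twist_inj E (fun=> u)).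
move=> phix; exists (phi \o q'); split=> [|z]; last by rewrite /= qK.
apply: (turns_uncomp (u := [::]) (v := u) qK) => //.
by case: (twist_realizes (fun=> u) x).
Qed.

(** After division by a twist, phi commutes with the pairings at x.  The other
    points of the fibre are reached from x by the pairings, and any two pairings
    compose to the third, so phi commutes with them there as well. *)
Lemma turns_fibre (E E' : finType) (phi : arrow_end E -> arrow_end E') u x y :
  x.1.1 = y.1.1 -> turns phi u x -> turns phi u y.
Proof.
move=> xy /turns_factor[theta [thetax phiE]].
have /turns_nil_fibre/(_ thetax) thetay :
    (twist_fun (fun=> u) x).1.1 = (twist_fun (fun=> u) y).1.1 by [].
have [_ qy] := twist_realizes (fun=> u) y.
have := turns_comp thetay qy; rewrite /turns phiE => ->.
by apply: eq_tmap => z; rewrite phiE.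
Qed.

Lemma turns_label (E E' : finType) (phi : arrow_end E -> arrow_end E') u x y :
  turns phi u x -> x.1.1 = y.1.1 -> (phi x).1.1 = (phi y).1.1.
Proof.
move=> /turns_factor[theta [[Es Ef Eo] phiE]] xy; rewrite !phiE /=.
have : (twist_fun (fun=> u) x).1.1 = (twist_fun (fun=> u) y).1.1 by [].
move: (twist_fun _ y); apply: fibre_ind => //; by rewrite -?Es -?Ef -?Eo.
Qed.

(** * Twisted duality in terms of pairings *)

Lemma relabel_end_turns (E E' : finType) (fe : E -> E') s r x :
  turns (relabel_end fe s r) [::] x.
Proof.
case: x => [[e i] h].
by rewrite /turns /corners /relabel_end /opposite /side /flip /mate /= !addNb.
Qed.

Lemma relabel_arrow_bij (E E' : finType) (fe : E -> E') (s : E -> bool) :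
  bijective fe -> bijective (fun a : arrow E => (fe a.1, a.2 (+) s a.1)).
Proof.
case=> g feK gK; exists (fun a => (g a.1, a.2 (+) s (g a.1))) => -[e b] /=.
  by rewrite feK addbK.
by rewrite gK addbK.
Qed.

Lemma relabel_end_bij (E E' : finType) (fe : E -> E') s r :
  bijective fe -> bijective (relabel_end fe s r).
Proof.
case=> g feK gK; exists (relabel_end g (s \o g) (r \o g)) => -[[e i] h].
  by rewrite /relabel_end /= !feK !addbK.
by rewrite /relabel_end /= !gK !addbK.
Qed.

(** The induced map on labels is onto since phi is, and the fibres on both sides
    have four elements, so that the two label sets are equinumerous. *)
Lemma label_bij (E E' : finType) (phi : arrow_end E -> arrow_end E')
    (w : E -> twist_word) :
  bijective phi -> (forall x, turns phi (w x.1.1) x) ->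
  bijective (fun e => (phi (e, true, true)).1.1).
Proof.
move=> phi_bij phi_t; have [psi phiK psiK] := phi_bij.
set fe := fun e => _; have labE x : (phi x).1.1 = fe x.1.1.
  exact: (turns_label (phi_t x) (y := (x.1.1, true, true))).
have fe_surj e' : exists e, fe e = e'.
  by exists (psi (e', true, true)).1.1; rewrite -labE psiK.
have [g gP] := fin_all_exists fe_surj.
have cardE : #|E| = #|E'|.
  have := bij_eq_card phi_bij; rewrite !card_prod card_bool -!mulnA.
  by move/eqP; rewrite eqn_pmul2r // => /eqP.
have [h gh hg] := inj_card_bij (can_inj gP) (eq_leq cardE).
exists g => // e; by rewrite -{1}[e]hg gP hg.
Qed.

Lemma relabel_endP (E E' : finType) (phi : arrow_end E -> arrow_end E') :
  bijective phi -> (forall x, turns phi [::] x) ->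
  exists (fe : E -> E') (s r : E -> bool),
    bijective fe /\ phi =1 relabel_end fe s r.
Proof.
move=> phi_bij phi_t; pose b e := phi (e, true, true).
exists (fun e => (b e).1.1), (fun e => ~~ (b e).1.2), (fun e => ~~ (b e).2).
split; first exact: (label_bij (w := fun=> [::])).
move=> x; have [Es Ef Eo] := phi_t (x.1.1, true, true).
have xx : (x.1.1, true, true).1.1 = x.1.1 by [].
move: x xx Es Ef Eo => [[e i] h] /= _; rewrite -/(b e) /relabel_end /=.
rewrite /side /flip /opposite /mate /side /flip /mate /=.
case bE: (b e) => [[e' i'] h'] /= Es Ef Eo.
by case: i h => [] []; rewrite -?Es -?Ef -?Eo ?[phi _]bE /= ?negbK.
Qed.

(** The independent choices of a relabelling at an edge, interchanging its
    arrows and reversing both, make up the Klein four-group, which is its own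
    centraliser in the permutations of the four points.  Hence preserving
    [side] and [flip] characterises relabellings. *)
Lemma embedded_equivP (G H : embedded_graph) :
  embedded_equiv G H <->
  isolated_vertices G = isolated_vertices H /\
  exists2 phi : arrow_end (edge G) -> arrow_end (edge H),
    arc_iso phi & forall x, turns phi [::] x.
Proof.
split=> [[iso [fe [s [r [fe_bij com]]]]]|[iso [phi [phi_bij com] phi_t]]].
  split=> //; exists (relabel_end fe s r); last exact: relabel_end_turns.
  by split=> //; apply: relabel_end_bij.
split=> //; have [fe [s [r [fe_bij phiE]]]] := relabel_endP phi_bij phi_t.
by exists fe, s, r; split=> // x; rewrite -!phiE.
Qed.

(** The equivalence theta from the rearranged graph and the map phi from G
    determine each other by phi = theta o q. *)
Lemma rearrangeP (G H : embedded_graph) (q : {perm arrow_end (edge G)}) w :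
  realizes q w ->
  embedded_equiv (rearrange q) H <->
  isolated_vertices G = isolated_vertices H /\
  exists2 phi : arrow_end (edge G) -> arrow_end (edge H),
    arc_iso phi & forall x, turns phi (w x.1.1) x.
Proof.
move=> qr; split.
  move/embedded_equivP => [iso [theta [theta_bij com] theta_t]]; split=> //.
  exists (theta \o q) => [|x].
    split=> [|x].
      by apply: bij_comp => //; exact: (Bijective (permK q) (permKV q)).
    by rewrite /= -com /= /rearranged_arc permK.
  by apply: (turns_comp (u := [::])); case: (qr x).
case=> iso [phi [phi_bij com] phi_t]; apply/embedded_equivP; split=> //.
exists (phi \o (q^-1)%g) => [|x].
  split=> [|x].
    by apply: bij_comp => //; exact: (Bijective (permKV q) (permK q)).
  by rewrite /= /rearranged_arc permK com.
rewrite -[x](permKV q); have [_ qx] := qr ((q^-1)%g x).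
exact: (turns_uncomp (u := [::]) (permK q) qx (phi_t _)).
Qed.

Lemma perm_twist_realizes (G : embedded_graph) (w : edge G -> twist_word) :
  realizes (perm (@twist_inj (edge G) w)) w.
Proof.
move=> x; rewrite permE; have [? xt] := twist_realizes w x; split=> //.
by rewrite /turns permE xt; apply: eq_tmap => y; rewrite permE.
Qed.

Definition twistP G H w := rearrangeP H (@perm_twist_realizes G w).

(** Words found separately at each point can be taken to depend on the label
    alone: the one found at the arrow end (e, true, true) serves for the whole
    fibre. *)
Lemma turns_choice (E E' : finType) (phi : arrow_end E -> arrow_end E')
    (K : Type) (W : K -> twist_word) :
  (forall x, exists k, turns phi (W k) x) ->
  exists k : E -> K, forall x, turns phi (W (k x.1.1)) x.
Proof.
move=> phi_t.
have [k kP] := fin_all_exists (fun e => phi_t (e, true, true)).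
by exists k => x; apply: turns_fibre (kP x.1.1).
Qed.

Lemma twistedP (G H : embedded_graph) :
  twisted_duals G H <->
  isolated_vertices G = isolated_vertices H /\
  exists2 phi : arrow_end (edge G) -> arrow_end (edge H),
    arc_iso phi & forall x, exists w, turns phi w x.
Proof.
split=> [[w /twistP[iso [phi phi_iso phi_t]]]|].
  by split=> //; exists phi => // x; exists (w x.1.1).
case=> iso [phi phi_iso /(turns_choice (W := id))[w wP]].
by exists w; apply/twistP; split=> //; exists phi.
Qed.

Lemma twisted_inP (g : twist_word) (G H : embedded_graph) :
  twisted_duals_in g G H <->
  isolated_vertices G = isolated_vertices H /\
  exists2 phi : arrow_end (edge G) -> arrow_end (edge H),
    arc_iso phi & forall x, exists k, turns phi (flatten (nseq k g)) x.
Proof.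
split=> [[w [wg /twistP[iso [phi phi_iso phi_t]]]]|].
  split=> //; exists phi => // x; have [k wE] := wg x.1.1.
  by exists k; rewrite -wE.
case=> iso [phi phi_iso /turns_choice[k kP]].
exists (fun e => flatten (nseq (k e) g)); split=> [e|]; first by exists (k e).
by apply/twistP; split=> //; exists phi.
Qed.

Lemma partial_dualsP (G H : embedded_graph) :
  partial_duals G H <->
  isolated_vertices G = isolated_vertices H /\
  exists2 phi : arrow_end (edge G) -> arrow_end (edge H),
    arc_iso phi & forall x, exists k : bool, turns phi (nseq k Delta) x.
Proof.
apply: (iff_trans (twisted_inP _ _ _)).
split=> -[iso [phi phi_iso phi_t]]; split=> //; exists phi => // x.
  have [k phix] := phi_t x; exists (odd k).
  by rewrite /turns -word_change_odd.
have [k phix] := phi_t x; exists (k : nat).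
by case: k phix.
Qed.

(** Attaching an edge disc along its sides instead of its arrows turns sides
    into arrows and arrows into sides. *)
Lemma dual_place_turns (E : finType) (A : {set E}) x :
  turns (dual_place A) (nseq (x.1.1 \in A) Delta) x.
Proof.
case: x => [[e i] h]; rewrite /turns /corners /opposite /side /flip /mate.
rewrite /dual_place /=; case: ifP => /= eA; rewrite ?eA //=.
by case: h; rewrite /= ?eA ?negbK.
Qed.

Lemma dual_placeV_realizes (E : finType) (A : {set E}) :
  realizes (perm (@dual_place_inj E A))^-1%g (fun e => nseq (e \in A) Delta).
Proof.
move=> x; set p := perm _.
have labE y : (p y).1.1 = y.1.1.
  by rewrite permE /dual_place; case: ifP => // _; case: ifP.
have pt y : turns p (nseq (y.1.1 \in A) Delta) y.
  rewrite /turns permE dual_place_turns; apply: eq_tmap => z; by rewrite permE.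
have lab : ((p^-1)%g x).1.1 = x.1.1 by rewrite -labE permKV.
split=> //; rewrite /turns; have := pt ((p^-1)%g x).
rewrite /turns permKV lab => ->.
by rewrite word_change_tmap (tmap_can (permK p)) word_change_Delta.
Qed.

Lemma componentwise_dualsP (G H : embedded_graph) :
  componentwise_geometric_duals G H <->
  isolated_vertices G = isolated_vertices H /\
  exists (phi : arrow_end (edge G) -> arrow_end (edge H)) (k : edge G -> bool),
    [/\ arc_iso phi, forall x, turns phi (nseq (k x.1.1) Delta) x
      & forall x, k (circle_arc x).1.1 = k x.1.1].
Proof.
split.
  case=> A Ac /(rearrangeP _ (@dual_placeV_realizes _ A)).
  by case=> iso [phi phi_iso phi_t]; split=> //; exists phi, (mem A).
case=> iso [phi [k [phi_iso phi_t kc]]].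
exists [set e | k e] => [x|]; first by rewrite !inE kc.
apply/(rearrangeP _ (@dual_placeV_realizes _ _)); split=> //.
by exists phi => // x; rewrite inE.
Qed.

Lemma geometric_duals_componentwise G H :
  geometric_duals G H -> componentwise_geometric_duals G H.
Proof.
case.
  move/embedded_equivP => [iso [phi phi_iso phi_t]].
  by apply/componentwise_dualsP; split=> //; exists phi, (fun=> false).
by exists [set: edge G] => // x; rewrite !inE.
Qed.

(** Otherwise an end with label in A and one with label outside have distinct
    roots, which makes two components. *)
Lemma connected_component (G : embedded_graph) (A : {set edge G}) :
  connected_graph G -> union_of_components A -> A = set0 \/ A = setT.
Proof.
move=> Gc Ac; case: (set_0Vmem A) => [|[a aA]]; first by left.
right; apply/setP => b; rewrite inE; apply/negPn/negP => bA.
pose e := @component_step G.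
have e_sym : symmetric e.
  move=> x y; rewrite /e /component_step /= [in LHS]eq_sym; congr (_ || _).
  by apply/eqP/eqP => ->; rewrite circle_arcK.
have esym : connect_sym e by apply: sym_connect_sym.
have Acon x y : connect e x y -> (x.1.1 \in A) = (y.1.1 \in A).
  case/connectP=> p; elim: p x => [x _ -> //|z p IHp] x /= /andP[xz zp] ey.
  by rewrite -(IHp z zp ey); case/orP: xz => /eqP->; rewrite ?Ac.
pose x : arrow_end (edge G) := (a, true, true).
pose y : arrow_end (edge G) := (b, true, true).
have xy : root e x != root e y.
  apply: contraNneq bA => xy; rewrite -(Acon x y) //.
  exact/(rootP esym).
move: Gc; rewrite /connected_graph => /(leq_trans (leq_addr _ _)).
rewrite leqNgt => /negP[]; rewrite -/e.
have -> : 2 = #|[set root e x; root e y]| by rewrite cards2 xy.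
apply: subset_leq_card; apply/subsetP => z; rewrite !inE andbT.
by case/orP => /eqP ->; apply: roots_root.
Qed.

Lemma connected_geometric_dualsP (G H : embedded_graph) :
  connected_graph G ->
  componentwise_geometric_duals G H <-> geometric_duals G H.
Proof.
move=> Gc; split; last exact: geometric_duals_componentwise.
case=> A /(connected_component Gc)[] -> GH; last by right.
left; apply/embedded_equivP.
case/(rearrangeP _ (@dual_placeV_realizes _ _)): GH => iso [phi phi_iso phi_t].
by split=> //; exists phi => // x; have := phi_t x; rewrite inE.
Qed.

(** * Medial graphs in coordinates *)

Section MedialCoordinates.
Variable G : embedded_graph.
Implicit Types (x : arrow_end (edge G)) (y : arrow_end (medial_edge G)).

Lemma medial_half_mate (a : arrow (medial_edge G)) :
  medial_half (mate a) = circle_arc (medial_half a).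
Proof. by case: a => m [] //=; rewrite /medial_half /= circle_arcK. Qed.

Lemma medial_split_flip y :
  medial_split (flip y) = ((medial_split y).1, ~~ (medial_split y).2).
Proof. by rewrite /medial_split /medial_black /flip /= addbN. Qed.

Lemma medial_split_side y :
  medial_split (side y) =
  (circle_arc (medial_split y).1, (medial_split y).2).
Proof.
rewrite /medial_split /side /= medial_half_mate; congr (_, _).
by rewrite /medial_black /mate /= addNb addbN negbK.
Qed.

Lemma medial_split_arc (y : arrow_end (edge (medial G))) :
  medial_split (circle_arc y) = medial_corner (medial_split y).
Proof. exact: medial_unsplitK. Qed.

Lemma medial_split_bij : bijective (@medial_split G).
Proof. exact: Bijective (@medial_splitK G) (@medial_unsplitK G). Qed.

Definition medial_unhalf x : arrow (medial_edge G) :=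
  (medial_unsplit (x, true)).1.

Lemma medial_unhalfK : cancel medial_unhalf (@medial_half G).
Proof.
by move=> x; rewrite -[LHS]/(medial_split (medial_unsplit (x, true))).1
  medial_unsplitK.
Qed.

Lemma medial_halfK : cancel (@medial_half G) medial_unhalf.
Proof.
move=> a; rewrite /medial_unhalf.
have -> : (medial_half a, true) = medial_split (a, ~~ a.2).
  by rewrite /medial_split /medial_black /= addbN addbb.
by rewrite medial_splitK.
Qed.

Lemma medial_half_bij : bijective (@medial_half G).
Proof. exact: Bijective medial_halfK medial_unhalfK. Qed.

Lemma medial_unhalf_bij : bijective medial_unhalf.
Proof. exact: Bijective medial_unhalfK medial_halfK. Qed.

Lemma medial_unhalf_arc x :
  medial_unhalf (circle_arc x) = mate (medial_unhalf x).
Proof.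
by apply: (can_inj medial_halfK); rewrite medial_half_mate !medial_unhalfK.
Qed.

Lemma medial_same_vertexE (a b : arrow (edge (medial G))) :
  same_vertex a b = ((medial_half a).1.1 == (medial_half b).1.1).
Proof. exact: (medial_connectE (a, true) (b, true)). Qed.

End MedialCoordinates.

(** * Embedded medial graphs and partial Petrials *)

Section MedialMaps.
Variables G H : embedded_graph.
Implicit Types (phi : arrow_end (edge G) -> arrow_end (edge H))
  (psi : arrow_end (edge (medial G)) -> arrow_end (edge (medial H))).

(** The lifted map exchanges the colours of the flags at v_e exactly when k e
    holds, that is, when phi exchanges the black and the white pairing there.
    Along an edge of the medial graph the two ends may disagree about the
    exchange, which twists that edge. *)
Lemma medial_lift phi (k : edge G -> bool) :
  arc_iso phi -> (forall x, turns phi (nseq (k x.1.1) Delta) x) ->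
  exists psi,
    [/\ arc_iso psi,
        forall y, let x := medial_half y.1 in
          turns psi (nseq (k x.1.1 (+) k (circle_arc x).1.1) Tau) y
      & forall y, medial_split (psi y) =
          (phi (medial_half y.1), medial_black y (+) k (medial_half y.1).1.1)].
Proof.
case=> phi_bij phi_arc phi_t; pose k' (x : arrow_end (edge G)) := k x.1.1.
pose Phi (z : arrow_end (edge G) * bool) := (phi z.1, z.2 (+) k' z.1).
pose psi (y : arrow_end (edge (medial G))) : arrow_end (edge (medial H)) :=
  medial_unsplit (Phi (medial_split y)).
have psiE y : medial_split (psi y) = Phi (medial_split y).
  exact: medial_unsplitK.
have split_inj := can_inj (@medial_splitK H).
have Phi_bij : bijective Phi.
  have [g phiK gK] := phi_bij.
  exists (fun z => (g z.1, z.2 (+) k' (g z.1))) => -[x c].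
    by rewrite /Phi /= phiK addbK.
  by rewrite /Phi /= gK addbK.
exists psi; split; last exact: psiE.
  split=> [|y].
    apply: bij_comp (bij_comp Phi_bij (medial_split_bij G)).
    exact: Bijective (@medial_unsplitK H) (@medial_splitK H).
  apply: split_inj; rewrite psiE !medial_split_arc psiE.
  case: (medial_split y) => x c; rewrite /medial_corner /Phi /=.
  have -> : k' (if c then flip x else side x) = k' x by case: c.
  congr (_, _); have := phi_t x; rewrite /turns -/(k' x).
  by case: (k' x) c => [] [] [] /=.
move=> y x; have xE : x = (medial_split y).1 by [].
clearbody x.
have psif z : psi (flip z) = flip (psi z).
  apply: split_inj; rewrite medial_split_flip !psiE medial_split_flip /Phi /=.
  by rewrite addNb.
have psis : psi (side y) = if k' x (+) k' (circle_arc x)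
    then opposite (psi y) else side (psi y).
  apply: split_inj; rewrite psiE medial_split_side /Phi -xE phi_arc /=.
  rewrite -flip_side (fun_if (@medial_split H)) medial_split_flip.
  rewrite medial_split_side psiE /Phi -xE /=.
  by case: (k' x) (k' (circle_arc x)) => [] []; rewrite /= ?addbT ?addbF ?negbK.
rewrite /turns /corners -[k _]/(k' x).
rewrite -[k (circle_arc x).1.1]/(k' (circle_arc x)).
case: (k' x (+) k' (circle_arc x)) psis => psis /=;
by rewrite -!flip_side !psif psis -?flip_side ?flipK.
Qed.

(** A map of flags commuting with [flip] is determined by its effect phi on
    arrow ends and by a bit telling whether the two colours are exchanged.
    Commuting with the corners forces that bit to be constant around a vertex,
    and phi to exchange [flip] and [side] exactly where the colours are
    exchanged. *)
Lemma medial_descend psi :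
  arc_iso psi -> (forall y, exists j : bool, turns psi (nseq j Tau) y) ->
  exists phi (k : edge G -> bool),
    [/\ arc_iso phi, forall x, turns phi (nseq (k x.1.1) Delta) x
      & forall y, medial_split (psi y) =
          (phi (medial_half y.1), medial_black y (+) k (medial_half y.1).1.1)].
Proof.
case=> psi_bij psi_arc psi_t.
pose Psi z := medial_split (psi (medial_unsplit z)).
have PsiE y : medial_split (psi y) = Psi (medial_split y).
  by rewrite /Psi medial_splitK.
have Psi_bij : bijective Psi.
  apply: bij_comp (medial_split_bij H) (bij_comp psi_bij _).
  exact: Bijective (@medial_unsplitK G) (@medial_splitK G).
clearbody Psi.
pose phi x := (Psi (x, true)).1; pose k' x := ~~ (Psi (x, true)).2.
have psif y : psi (flip y) = flip (psi y).
  by have [[] [_ ->]] := psi_t y.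
have Psi_eq z : Psi z = (phi z.1, z.2 (+) k' z.1).
  case: z => x []; rewrite /phi /k' /=; first by rewrite negbK; case: (Psi _).
  have -> : (x, false) = medial_split (flip (medial_unsplit (x, true))).
    by rewrite medial_split_flip medial_unsplitK.
  rewrite -PsiE psif medial_split_flip PsiE medial_unsplitK.
  by case: (Psi _).
have phi_bij : bijective phi.
  apply: inj_card_bij.
    move=> x x' xx'; have := bij_inj Psi_bij.
    move=> /(_ (x, k' x) (x', k' x')); rewrite !Psi_eq /= !addbb xx'.
    by case/(_ erefl).
  have := bij_eq_card Psi_bij; rewrite !(card_prod (arrow_end _)) card_bool.
  by move/eqP; rewrite eqn_pmul2r // => /eqP ->.
have phi_arc x : phi (circle_arc x) = circle_arc (phi x).
  pose y := medial_unsplit (x, true).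
  have yE : medial_split y = (x, true) by rewrite medial_unsplitK.
  have : (medial_split (psi (side y))).1 = circle_arc (medial_split (psi y)).1.
    have sE : (medial_split (side (psi y))).1
      = circle_arc (medial_split (psi y)).1 by rewrite medial_split_side.
    have oE : (medial_split (opposite (psi y))).1
      = circle_arc (medial_split (psi y)).1.
      by rewrite -flip_side medial_split_flip.
    by have [[] [Es _ Eo]] := psi_t y; [rewrite -Eo | rewrite -Es].
  by rewrite !PsiE medial_split_side !Psi_eq yE.
have Psi_corner z : Psi (medial_corner z) = medial_corner (Psi z).
  rewrite -{2}[z]medial_unsplitK -PsiE -medial_split_arc -psi_arc PsiE.
  by rewrite medial_split_arc medial_unsplitK.
have phi_flip x : phi (flip x) = if k' x then side (phi x) else flip (phi x).
  have := Psi_corner (x, true); rewrite !Psi_eq /= => -[-> _].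
  by case: (k' x).
have k_flip x : k' (flip x) = k' x.
  have := Psi_corner (x, true); rewrite !Psi_eq /= => -[_].
  by move/negb_inj.
have phi_side x : phi (side x) = if k' x then flip (phi x) else side (phi x).
  by have := Psi_corner (x, false); rewrite !Psi_eq /= => -[-> _].
have k_side x : k' (side x) = k' x.
  by have := Psi_corner (x, false); rewrite !Psi_eq /= => -[_].
pose k e := k' (e, true, true).
have kE x : k' x = k x.1.1.
  rewrite /k; set x0 := (x.1.1, true, true).
  have : x0.1.1 = x.1.1 by []; clearbody x0.
  by move: x; apply: fibre_ind; rewrite /opposite ?k_side ?k_flip.
exists phi, k; split=> // [x|y]; last by rewrite PsiE Psi_eq kE.
rewrite /turns /corners -kE; case kx: (k' x) => /=;
  by rewrite /opposite !(phi_side, phi_flip, k_flip) kx ?kleinE.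
Qed.

(** An edge of the medial graph is untwisted when the colour exchange is the
    same at both of its ends; if this holds everywhere, then the edges of G with
    colour exchange form a union of components. *)
Lemma medial_embedded_equivP :
  faced embedded_equiv (medial G) (medial H) <->
  componentwise_geometric_duals G H.
Proof.
split.
  case=> /embedded_equivP[_ [psi psi_iso psi_t]] iso.
  have [|phi [k [phi_iso phi_t psiE]]] := medial_descend psi_iso.
    by move=> y; exists false.
  apply/componentwise_dualsP; split=> //; exists phi, k; split=> // x.
  pose y := medial_unsplit (x, true).
  have yE : medial_split y = (x, true) by rewrite medial_unsplitK.
  have [sE _ _] := psi_t y.
  have := congr1 (fun z => (medial_split z).2) sE.
  rewrite medial_split_side !psiE /=.
  rewrite -[medial_half (mate _)]/(medial_split (side y)).1.
  rewrite -[medial_black (side y)]/(medial_split (side y)).2.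
  rewrite medial_split_side -[medial_half y.1]/(medial_split y).1.
  by rewrite -[medial_black y]/(medial_split y).2 yE => /negb_inj.
case/componentwise_dualsP => iso [phi [k [phi_iso phi_t kE]]]; split=> //.
have [psi [psi_iso psi_t _]] := medial_lift phi_iso phi_t.
apply/embedded_equivP; split=> //; exists psi => // y.
by have := psi_t y; rewrite /= kE addbb.
Qed.

Lemma medial_partial_petrialsP :
  faced partial_petrials (medial G) (medial H) <-> partial_duals G H.
Proof.
split.
  case=> /twisted_inP[_ [psi psi_iso psi_t]] iso.
  have [|phi [k [phi_iso phi_t _]]] := medial_descend psi_iso.
    move=> y; have [j jP] := psi_t y; exists (odd j).
    by rewrite /turns -word_change_odd.
  by apply/partial_dualsP; split=> //; exists phi => // x; exists (k x.1.1).
case/partial_dualsP => iso [phi phi_iso /turns_choice[k phi_t]]; split=> //.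
have [psi [psi_iso psi_t _]] := medial_lift phi_iso phi_t.
apply/twisted_inP; split=> //; exists psi => // y.
move: (psi_t y) => /=; set j := _ (+) _ => psi_y; exists (j : nat).
by case: j psi_y.
Qed.
End MedialMaps.

(** * Locally embedded and abstract medial graphs *)

Section LocalMaps.
Variable G : embedded_graph.
Implicit Types (x : arrow_end (edge G)).

(** A local orientation o is reversed by the black and by the white pairing, so
    the rotation alternates between the two pairings around a vertex. *)
Lemma medial_rotation (out : arrow_end (edge (medial G)) -> bool) :
  local_orientation out ->
  exists o : arrow_end (edge G) -> bool,
    [/\ forall x, o (flip x) = ~~ o x, forall x, o (side x) = ~~ o x
      & forall a, medial_half (rotation out a) =
          let x := medial_half a in if o x then flip x else side x].
Proof.
move=> outP; pose o x := out (medial_unsplit (x, true)).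
have outE y : out y = ((medial_split y).2 == o (medial_split y).1).
  rewrite -{1}[y]medial_splitK; case: (medial_split y) => x [].
    by rewrite /o; case: (out _).
  rewrite /= /o.
  have -> : medial_unsplit (x, true) = flip (medial_unsplit (x, false)).
    apply: (can_inj (@medial_splitK G)).
    by rewrite medial_split_flip !medial_unsplitK.
  by have [-> _] := outP (medial_unsplit (x, false)); case: (out _).
have corner z :
    out (medial_unsplit (medial_corner z)) = ~~ out (medial_unsplit z).
  have [_ <-] := outP (medial_unsplit z); congr out.
  apply: (can_inj (@medial_splitK G)).
  by rewrite medial_split_arc !medial_unsplitK.
exists o; split=> [x|x|a]; first exact: (corner (x, true)).
  have := corner (x, false); rewrite !outE !medial_unsplitK /=.
  by case: (o _) (o _) => [] [].
rewrite /rotation; set y := (a, out (a, true)).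
rewrite -[medial_half _]/(medial_split (circle_arc y)).1 medial_split_arc.
have yE : medial_split y = (medial_half a, o (medial_half a)).
  congr (_, _); rewrite /medial_black /y /= outE /= /medial_black /=.
  by case: a.2 (o _) => [] [].
by rewrite yE.
Qed.

Lemma medial_orientation (o : arrow_end (edge G) -> bool) :
  (forall x, o (flip x) = ~~ o x) -> (forall x, o (side x) = ~~ o x) ->
  exists2 out : arrow_end (edge (medial G)) -> bool, local_orientation out
    & forall a, medial_half (rotation out a) =
          let x := medial_half a in if o x then flip x else side x.
Proof.
move=> o_flip o_side.
exists (fun y => (medial_split y).2 == o (medial_split y).1) => [y|a].
  rewrite medial_split_arc medial_split_flip.
  case: (medial_split y) => x []; rewrite /= ?o_flip ?o_side; by case: (o x).
rewrite /rotation; set h := _ == _.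
rewrite -[medial_half _]/(medial_split (circle_arc (a, h : bool))).1.
rewrite medial_split_arc.
have -> : medial_split (a, h) = (medial_half a, o (medial_half a)).
  congr (_, _); rewrite /medial_black /h /= /medial_black /=.
  by case: a.2 (o _) => [] [].
by [].
Qed.
End LocalMaps.

Section LocalAbstract.
Variables G H : embedded_graph.
Implicit Types phi : arrow_end (edge G) -> arrow_end (edge H).

Lemma medial_half_map (f : arrow (edge (medial G)) -> arrow (edge (medial H))) :
  bijective f -> (forall a, f (mate a) = mate (f a)) ->
  exists phi, arc_iso phi /\ forall a, phi (medial_half a) = medial_half (f a).
Proof.
move=> f_bij f_mate; exists (fun x => medial_half (f (medial_unhalf x))).
split=> [|a]; last by rewrite medial_halfK.
split=> [|x]; last by rewrite medial_unhalf_arc f_mate medial_half_mate.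
exact: bij_comp (medial_half_bij H) (bij_comp f_bij (medial_unhalf_bij G)).
Qed.

Lemma medial_unhalf_map phi :
  arc_iso phi ->
  exists f : arrow (edge (medial G)) -> arrow (edge (medial H)),
    [/\ bijective f, forall a, f (mate a) = mate (f a)
      & forall a, medial_half (f a) = phi (medial_half a)].
Proof.
case=> phi_bij phi_arc; exists (fun a => medial_unhalf (phi (medial_half a))).
split=> [|a|a]; last by rewrite medial_unhalfK.
  exact: bij_comp (medial_unhalf_bij H) (bij_comp phi_bij (medial_half_bij G)).
by rewrite medial_half_mate phi_arc medial_unhalf_arc.
Qed.

(** In one direction, a map commuting with rotations also commutes with their
    powers; the second power is the crossing pairing and the third is the
    inverse rotation, which applies the pairing that the rotation itself does
    not apply.  In the other direction an orientation of the medial graph of G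
    is transported along phi, and reversed at the vertices where phi exchanges
    the black and the white pairing. *)
Lemma medial_locally_embeddedP :
  faced locally_embedded_equiv (medial G) (medial H) <-> partial_duals G H.
Proof.
split.
  case=> -[_ [outG [outH [f [outGP outHP f_bij f_mate f_rot]]]]] iso.
  have [o [o_flip o_side rotG]] := medial_rotation outGP.
  have [o' [o_flip' o_side' rotH]] := medial_rotation outHP.
  have [phi [phi_iso phiE]] := medial_half_map f_bij f_mate.
  pose rot x := if o x then flip x else side x.
  pose rot' x := if o' x then flip x else side x.
  have phi_rot x : phi (rot x) = rot' (phi x).
    have {rotG} := rotG (medial_unhalf x); rewrite /= medial_unhalfK.
    move: (rotH (f (medial_unhalf x))).
    rewrite -f_rot /= -!phiE medial_unhalfK => E2 E1.
    by rewrite /rot' -E2 E1.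
  apply/partial_dualsP; split=> //; exists phi => // x.
  have := phi_rot x.
  have : phi (rot (rot x)) = rot' (rot' (phi x)) by rewrite !phi_rot.
  have : phi (rot (rot (rot x))) = rot' (rot' (rot' (phi x))).
    by rewrite !phi_rot.
  rewrite /rot /rot' /turns /corners.
  by case ox: (o x); case ox': (o' (phi x));
    do ?rewrite (o_flip, o_side, o_flip', o_side', flipK, ox, ox') /=;
    rewrite ?kleinE
      => E3 E2 E1;
    [exists false | exists true | exists true | exists false];
    rewrite /= E1 ?E2 ?E3.
case/partial_dualsP => iso [phi phi_iso /turns_choice[k phi_t]].
have [phi_bij _] := phi_iso; have [g phiK gK] := phi_bij.
(* The second bit is reversed by [flip] and by [side], so it orients each
   circle of the medial graph of G. *)
pose o (x : arrow_end (edge G)) := x.2.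
pose o' y := o (g y) (+) k (g y).1.1.
have o_flip x : o (flip x) = ~~ o x by [].
have o_side x : o (side x) = ~~ o x by [].
have phiE x : turns phi (nseq (k x.1.1) Delta) x := phi_t x.
have o_flip' y : o' (flip y) = ~~ o' y.
  rewrite -[y]gK /o'; have := phiE (g y); rewrite /turns /corners.
  by case kx: (k (g y).1.1) => -[_ -> _]; rewrite !phiK /= kx ?addbF ?addbT.
have o_side' y : o' (side y) = ~~ o' y.
  rewrite -[y]gK /o'; have := phiE (g y); rewrite /turns /corners.
  by case kx: (k (g y).1.1) => -[-> _ _]; rewrite !phiK /= kx ?addbF ?addbT.
have [outG outGP rotG] := medial_orientation o_flip o_side.
have [outH outHP rotH] := medial_orientation o_flip' o_side'.
have [f [f_bij f_mate fE]] := medial_unhalf_map phi_iso.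
split=> //; split=> //; exists outG, outH, f; split=> // a.
apply: (can_inj (@medial_halfK H)); rewrite fE rotG rotH fE /=.
set x := medial_half a; rewrite /o' phiK.
have := phiE x; rewrite /turns /corners.
by case: (k x.1.1) => -[Es Ef _]; case: (o x); rewrite /= ?Es ?Ef.
Qed.

Lemma arrow_mapP (E E' : finType) (f : arrow E -> arrow E') :
  bijective f -> (forall a, f (mate a) = mate (f a)) ->
  exists (fe : E -> E') (s : E -> bool),
    bijective fe /\ forall a, f a = (fe a.1, a.2 (+) s a.1).
Proof.
move=> [g fK gK] f_mate.
have g_mate a : g (mate a) = mate (g a).
  by rewrite -{1}[a]gK -f_mate fK.
have labE (A B : finType) (h : arrow A -> arrow B) :
    (forall a, h (mate a) = mate (h a)) ->
    forall a, h a = ((h (a.1, true)).1, a.2 (+) ~~ (h (a.1, true)).2).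
  move=> h_mate [e []] /=; first by rewrite negbK; case: (h _).
  by rewrite -[(e, false)]/(mate (e, true)) h_mate.
exists (fun e => (f (e, true)).1), (fun e => ~~ (f (e, true)).2).
split; last exact: labE.
exists (fun e => (g (e, true)).1) => e.
  have := congr1 fst (fK (e, true)); rewrite {1}(labE _ _ g) //.
have := congr1 fst (gK (e, true)); rewrite {1}(labE _ _ f) //.
Qed.

(** The three points other than phi x are the images of the three points other
    than x, in one of six orders, and each order comes from a word. *)
Lemma turns_exists phi x :
  injective phi -> (forall y, y.1.1 = x.1.1 -> (phi y).1.1 = (phi x).1.1) ->
  exists w, turns phi w x.
Proof.
move=> phi_inj phi_lab.
have neq y z : y != z -> phi y <> phi z by move/eqP => yz /phi_inj.
have [sx fx ox] : [/\ side x != x, flip x != x & opposite x != x].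
  by case: (x) => [[e []] []]; split; apply/eqP.
have [sf so fo] :
    [/\ side x != flip x, side x != opposite x & flip x != opposite x].
  by case: (x) => [[e []] []]; split; apply/eqP.
move: sx fx ox sf so fo => /neq sx /neq fx /neq ox /neq sf /neq so /neq fo.
have lab y : y.1.1 = x.1.1 -> (phi x).1.1 = (phi y).1.1.
  by move=> yx; rewrite phi_lab.
have found w : (side (phi x), flip (phi x), opposite (phi x))
    = tmap phi (word_change w (side x, flip x, opposite x)) ->
    exists w, turns phi w x by exists w.
have [//|Es|Es|Es] := fibreP (lab (side x) erefl);
have [//|Ef|Ef|Ef] := fibreP (lab (flip x) erefl);
have [//|Eo|Eo|Eo] := fibreP (lab (opposite x) erefl);
first [ by case: sf; rewrite Es Ef | by case: so; rewrite Es Eo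
      | by case: fo; rewrite Ef Eo
      | by apply: (found [::]); rewrite /= Es Ef Eo
      | by apply: (found [:: Delta]); rewrite /= Es Ef Eo
      | by apply: (found [:: Tau]); rewrite /= Es Ef Eo
      | by apply: (found [:: Delta; Tau]); rewrite /= Es Ef Eo
      | by apply: (found [:: Tau; Delta]); rewrite /= Es Ef Eo
      | by apply: (found [:: Delta; Tau; Delta]); rewrite /= Es Ef Eo ].
Qed.

End LocalAbstract.

Lemma vertex_at_surj (G : embedded_graph) (C : nonisolated_vertex G) :
  exists a, C = vertex_at a.
Proof.
case: C => C CP; have /existsP[[a h] /eqP CE] := CP; exists a; apply: val_inj.
rewrite /= {CP}CE; case: h => //.
have flip_step x : connect (@circle_step G) x (flip x).
  by apply: connect1; apply/orP; left.
apply/setP => y; rewrite !inE; apply/idP/idP; apply: connect_trans.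
  exact: (flip_step (a, true)).
exact: (flip_step (a, false)).
Qed.

(** Only circles carrying an arrow are ever reached by f, and each of them is
    mapped through an arbitrarily chosen arrow on it. *)
Lemma abstract_equivI (G H : embedded_graph)
    (f : arrow (edge G) -> arrow (edge H)) :
  isolated_vertices G = isolated_vertices H ->
  bijective f -> (forall a, f (mate a) = mate (f a)) ->
  (forall a b,
     vertex_at (f a) = vertex_at (f b) <-> vertex_at a = vertex_at b) ->
  abstract_equiv G H.
Proof.
move=> iso f_bij f_mate f_vertex.
have [fe [s [fe_bij fE]]] := arrow_mapP f_bij f_mate.
have [g fK gK] := f_bij.
have [rG rGP] := fin_all_exists (@vertex_at_surj G).
have [rH rHP] := fin_all_exists (@vertex_at_surj H).
pose fv (u : mg_vertex (abstract_graph G)) : mg_vertex (abstract_graph H) :=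
  match u with
  | inl C => inl (vertex_at (f (rG C)))
  | inr i => inr (cast_ord iso i)
  end.
pose gv (u : mg_vertex (abstract_graph H)) : mg_vertex (abstract_graph G) :=
  match u with
  | inl C => inl (vertex_at (g (rH C)))
  | inr i => inr (cast_ord (esym iso) i)
  end.
exists fv, fe, s; split=> // [|e b].
  exists gv => -[C|i] /=; rewrite ?cast_ordK ?cast_ordKV //; congr inl.
    by rewrite [RHS]rGP; apply/f_vertex; rewrite gK -rHP.
  by rewrite [RHS]rHP -[in RHS](gK (rH C)); apply/f_vertex; rewrite -rGP.
rewrite /= -[(fe e, _)]/(fe (e, b).1, (e, b).2 (+) s (e, b).1) -fE.
by congr inl; apply/f_vertex; rewrite -rGP.
Qed.

Lemma medial_vertex_atP (G : embedded_graph) (a b : arrow (edge (medial G))) :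
  vertex_at a = vertex_at b <-> (medial_half a).1.1 = (medial_half b).1.1.
Proof.
split=> [[ab]|ab].
  apply/eqP; rewrite -medial_same_vertexE.
  have : (b, true) \in circle (b, true) by rewrite inE connect0.
  by rewrite -ab inE.
apply: val_inj; apply/setP => y; rewrite !inE.
by rewrite !medial_connectE -[(medial_split (a, true)).1]/(medial_half a) ab.
Qed.

Lemma medial_abstractP (G H : embedded_graph) :
  faced abstract_equiv (medial G) (medial H) <-> twisted_duals G H.
Proof.
split.
  case=> -[fv [fe [s [fv_bij fe_bij ends]]]] iso.
  pose f (a : arrow (edge (medial G))) : arrow (edge (medial H)) :=
    (fe a.1, a.2 (+) s a.1).
  have f_bij : bijective f by exact: relabel_arrow_bij.
  have f_mate a : f (mate a) = mate (f a) by rewrite /f /mate /= addNb.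
  have fvE a : inl (vertex_at (f a)) = fv (inl (vertex_at a)).
    by case: a => e b; apply: ends.
  have [phi [phi_iso phiE]] := medial_half_map f_bij f_mate.
  apply/twistedP; split=> //; exists phi => // x.
  apply: turns_exists => [|y]; first by case: phi_iso => /bij_inj.
  rewrite -[x]medial_unhalfK -[y]medial_unhalfK !phiE.
  move/medial_vertex_atP => xy; apply/medial_vertex_atP.
  by apply: (inl_inj (B := 'I_0)); rewrite !fvE xy.
case/twistedP => iso [phi phi_iso /(turns_choice (W := id))[w phi_t]].
split=> //; have [f [f_bij f_mate fE]] := medial_unhalf_map phi_iso.
apply: (abstract_equivI (f := f)) => // a b.
have lab_bij := label_bij (proj1 phi_iso) phi_t.
have labE x : (phi x).1.1 = (phi (x.1.1, true, true)).1.1.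
  exact: turns_label (phi_t x) _.
split; last first.
  move/medial_vertex_atP => ab; apply/medial_vertex_atP.
  by rewrite !fE labE ab -labE.
move/medial_vertex_atP; rewrite !fE labE [RHS]labE => ab.
by apply/medial_vertex_atP; apply: (bij_inj lab_bij).
Qed.

(** * Moves on checkerboard coloured graphs *)

(** What survives of a sequence of moves: an identification of the half-edges
    that preserves the edges and, at each half-edge, permutes the pairings by a
    power of g.  In contrast with a single move this composes, because the
    exponent may vary from one half-edge to another. *)
Definition linked (g : twist_word) (F F' : coloured_graph) : Prop :=
  isolated_faces F = isolated_faces F' /\
  exists f : arrow (edge F) -> arrow (edge F'),
    [/\ bijective f, forall a, f (mate a) = mate (f a)
      & forall a, exists k, pairings (f a) =
          tmap f (word_change (flatten (nseq k g)) (pairings a))].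

Lemma same_isolated_faces_eq (F F' : coloured_graph) :
  same_isolated_faces F F' -> isolated_faces F = isolated_faces F'.
Proof. by case=> g /bij_eq_card; rewrite !card_ord. Qed.

Lemma linked_trans g F F' F'' :
  linked g F F' -> linked g F' F'' -> linked g F F''.
Proof.
case=> iso [f [f_bij f_mate f_p]] [iso' [f' [f'_bij f'_mate f'_p]]].
split; first exact: etrans iso'.
exists (f' \o f); split=> [|a|a]; first exact: bij_comp.
  by rewrite /= f_mate f'_mate.
have [k kP] := f_p a; have [k' kP'] := f'_p (f a); exists (k' + k).
rewrite /= kP' kP word_change_tmap tmap_comp nseqD flatten_cat.
by rewrite word_change_cat.
Qed.

(** The corner of a given colour next to a half-edge is preserved because the
    isomorphism respects the colours of arrow ends. *)
Lemma coloured_iso_linked g F F' : coloured_iso F F' -> linked g F F'.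
Proof.
case=> /same_isolated_faces_eq iso [_ [fe [s [r [[fe_bij com] col]]]]].
split=> //; pose f (a : arrow (edge F)) : arrow (edge F') :=
  (fe a.1, a.2 (+) s a.1).
have relE a h : relabel_end fe s r (a, h) = (f a, h (+) r a.1) by [].
have f_bij : bijective f by exact: relabel_arrow_bij.
have f_mate a : f (mate a) = mate (f a) by rewrite /f /mate /= addNb.
have arcE y : (relabel_end fe s r y).1 = f y.1 by [].
clearbody f; have cornerE c a : corner_pairing c (f a) = f (corner_pairing c a).
  rewrite /corner_pairing; set h := _ == _; set h' := _ == _.
  have -> : (f a, h) = relabel_end fe s r (a, h').
    rewrite relE; congr (_, _); rewrite /h /h'.
    have := col (a, true); have := col (a, false); rewrite !relE.
    rewrite -[(a, false)]/(flip (a, true)) colour_checkerboard.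
    case: (r a.1) => /= E1 E2; rewrite ?E1 ?E2;
    by case: (colour _) c {h h'} => [] [].
  by rewrite -com.
exists f; split=> // a; exists 0.
rewrite /pairings /crossing_pairing /black_pairing /white_pairing.
by rewrite !cornerE.
Qed.

Lemma vertex_move_linked (change : forall T : Type, T * T * T -> T * T * T) g j
    F F' :
  (forall T t, change T t = word_change (flatten (nseq j g)) t) ->
  vertex_move change F F' -> linked g F F'.
Proof.
move=> changeE [/same_isolated_faces_eq iso [v [f [f_bij f_mate _ f_p]]]].
split=> //; exists f; split=> // a; rewrite f_p.
case: ifP => _; last by exists 0.
by exists j; rewrite changeE.
Qed.

Lemma equiv_under_linked (move : coloured_graph -> coloured_graph -> Prop) g
    F F' :
  (forall F F', move F F' -> linked g F F') ->
  equiv_under move F F' -> linked g F F'.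
Proof.
move=> move_linked; elim=> [{}F {}F' /coloured_iso_linked|] //.
by move=> {}F {}F' F'' /move_linked FF' _; apply: linked_trans.
Qed.

Lemma canonical_corner_pairing (G : embedded_graph) c
    (a : arrow (edge (canonical_medial G))) :
  medial_half (corner_pairing c a) =
  if c then flip (medial_half a) else side (medial_half a).
Proof.
rewrite /corner_pairing /=; set h := _ == _.
rewrite -[medial_half _]/(medial_split (@circle_arc (medial G) (a, h))).1.
rewrite medial_split_arc.
have -> : medial_split (a, h) = (medial_half a, c).
  congr (_, _); rewrite /h /medial_black /=.
  by case: a.2 c {h} => [] [].
by [].
Qed.

Lemma canonical_pairings (G : embedded_graph)
    (a : arrow (edge (canonical_medial G))) :
  tmap (@medial_half G) (pairings a) = corners (medial_half a).
Proof.
rewrite /pairings /crossing_pairing /black_pairing /white_pairing /=.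
by rewrite !canonical_corner_pairing.
Qed.

Lemma linked_canonical g (G H : embedded_graph) :
  linked g (canonical_medial G) (canonical_medial H) -> twisted_duals_in g G H.
Proof.
case=> iso [f [f_bij f_mate f_p]].
have [phi [phi_iso phiE]] := medial_half_map f_bij f_mate.
apply/twisted_inP; split=> //; exists phi => // x.
have [k kP] := f_p (medial_unhalf x); exists k.
rewrite /turns -{1}[x]medial_unhalfK phiE -canonical_pairings kP.
rewrite -{2}[x]medial_unhalfK -canonical_pairings word_change_tmap !tmap_comp.
by apply: eq_tmap => a /=; rewrite phiE.
Qed.

Lemma canonical_coloured_iso (G H : embedded_graph)
    (phi : arrow_end (edge G) -> arrow_end (edge H)) :
  isolated_vertices G = isolated_vertices H -> arc_iso phi ->
  (forall x, turns phi [::] x) ->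
  coloured_iso (canonical_medial G) (canonical_medial H).
Proof.
move=> iso phi_iso phi_t; split.
  exists (cast_ord iso) => //.
  exact: Bijective (cast_ordK iso) (cast_ordKV iso).
split=> //.
have [psi [[psi_bij psi_arc] psi_t psiE]] :=
  medial_lift (k := fun=> false) phi_iso phi_t.
have [fe [s [r [fe_bij psi_rel]]]] := relabel_endP psi_bij psi_t.
exists fe, s, r; split=> [|y]; first by split=> // y; rewrite -!psi_rel.
rewrite -psi_rel -[colour _]/(medial_split (psi y)).2 psiE /=.
exact: addbF.
Qed.

(** The permutation defining the twist identifies the half-edges of the two
    medial graphs; it commutes with the pairings except at v_e. *)
Lemma canonical_vertex_move (change : forall T : Type, T * T * T -> T * T * T) g
    (G : embedded_graph) (e : edge G) :
  (forall T t, change T t = word_change g t) ->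
  vertex_move change (canonical_medial G)
    (canonical_medial (twist (fun e' => if e' == e then g else [::]))).
Proof.
move=> changeE; set w := fun e' => _; pose p := perm (@twist_inj _ w).
split; first by exists id => //; exists id.
have p_iso : @arc_iso G (twist w) p.
  split=> [|x]; first exact: Bijective (permK p) (permKV p).
  by rewrite /= /rearranged_arc permK.
have [f [f_bij f_mate fE]] := medial_unhalf_map p_iso.
have fp a : (medial_half (f a)).1.1 = (medial_half a).1.1.
  by rewrite fE; case: (perm_twist_realizes w (medial_half a)).
exists (medial_unhalf (e, true, true)), f; split=> // [a b|a].
  by rewrite !medial_same_vertexE !fp.
have := medial_same_vertexE (medial_unhalf (e, true, true)) a.
rewrite medial_unhalfK eq_sym => ->.
apply: (can_inj (tmap_can (@medial_halfK (twist w)))).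
rewrite canonical_pairings fE.
have [_ ->] := perm_twist_realizes w (medial_half a).
rewrite -canonical_pairings.
have comE t : tmap p (tmap (@medial_half G) t)
    = tmap (@medial_half (twist w)) (tmap f t).
  by rewrite !tmap_comp; apply: eq_tmap => b /=; rewrite fE.
rewrite word_change_tmap comE /w; case: eqP => _ //=.
by rewrite changeE.
Qed.

(** Induction on the total exponent of g: while some edge e has a positive
    exponent, one move at v_e replaces G by its twist by g at e and lowers that
    exponent by one.  When all the exponents vanish, phi is an isomorphism. *)
Lemma equiv_under_canonical (move : coloured_graph -> coloured_graph -> Prop)
    (change : forall T : Type, T * T * T -> T * T * T) g
    (G H : embedded_graph) :
  (forall T t, change T t = word_change g t) ->
  (forall F F', vertex_move change F F' -> move F F') ->
  twisted_duals_in g G H ->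
  equiv_under move (canonical_medial G) (canonical_medial H).
Proof.
move=> changeE moveI /twisted_inP[iso [phi phi_iso /turns_choice[k phi_t]]].
have [n] := ubnP (\sum_e k e).
elim: n => // n IHn in G k iso phi phi_iso phi_t *; rewrite ltnS => k_le.
have [/existsP[e ke]|k0] := boolP [exists e, 0 < k e]; last first.
  apply/EquivIso/(canonical_coloured_iso iso phi_iso) => x.
  have := phi_t x; suff -> : k x.1.1 = 0 by [].
  by apply/eqP; rewrite -leqn0 leqNgt; move/existsPn: k0; apply.
apply: EquivStep (moveI _ _ (canonical_vertex_move e changeE)) _.
set w := fun e' => _; pose p := perm (@twist_inj _ w).
have [phi_bij phi_arc] := phi_iso.
pose k' e' := k e' - (e' == e).
apply: (IHn (twist w) k' iso (phi \o (p^-1)%g)).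
- split=> [|x].
    by apply: bij_comp => //; exact: Bijective (permKV p) (permK p).
  by rewrite /= /rearranged_arc permK phi_arc.
- move=> y; rewrite -[y](permKV p); set x := (p^-1)%g y.
  have [lab px] := perm_twist_realizes w x.
  apply: (turns_uncomp (permK p) px); rewrite lab /w /k'.
  have := phi_t x; case: (x.1.1 =P e) => [->|_]; last by rewrite subn0 cats0.
  have -> : flatten (nseq (k e - true) g) ++ g = flatten (nseq (k e) g) => //.
  by rewrite -{2}(subnK ke) nseqD flatten_cat /= cats0.
apply: leq_trans k_le; rewrite (bigD1 e) //= [X in _ < X](bigD1 e) //=.
rewrite -addSn leq_add //; first by rewrite /k' eqxx subn1 prednK.
by apply: leq_sum => i _; apply: leq_subr.
Qed.

(** * The hierarchy *)

Theorem theorem4p34 (G H : embedded_graph) :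
  ((geometric_duals G H -> faced embedded_equiv (medial G) (medial H)) /\
   (connected_graph G ->
      (faced embedded_equiv (medial G) (medial H) <-> geometric_duals G H)) /\
   (faced embedded_equiv (medial G) (medial H) <->
      componentwise_geometric_duals G H)) /\
  ((faced locally_embedded_equiv (medial G) (medial H) <-> partial_duals G H) /\
   (faced partial_petrials (medial G) (medial H) <-> partial_duals G H)) /\
  (faced abstract_equiv (medial G) (medial H) <-> twisted_duals G H) /\
  (equiv_under C3_move (canonical_medial G) (canonical_medial H) <->
     partial_trialities G H) /\
  (equiv_under C4_move (canonical_medial G) (canonical_medial H) <->
     partial_wilsonials G H).
Proof.
have C3E T t : @cycle_left T t = word_change [:: Delta; Tau] t.
  by case: t => [[]].
have C4E T t :
    @exchange_black_crossing T t = word_change [:: Tau; Delta; Tau] t.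
  by case: t => [[]].
split; last split; last split; last split.
- split; first by move/geometric_duals_componentwise/medial_embedded_equivP.
  split; last exact: medial_embedded_equivP.
  move=> Gc; apply: iff_trans (medial_embedded_equivP G H) _.
  exact: connected_geometric_dualsP.
- split; first exact: medial_locally_embeddedP.
  exact: medial_partial_petrialsP.
- exact: medial_abstractP.
- split=> [GH|]; last by apply: equiv_under_canonical C3E _ => F F'; left.
  apply/linked_canonical/(equiv_under_linked _ GH) => F F' [] FF'.
    by apply: (vertex_move_linked (j := 1)) FF' => T t; rewrite C3E.
  (* The other cyclic permutation is the square of the first. *)
  by apply: (vertex_move_linked (j := 2)) FF' => T [[a b] c].
split=> [GH|]; last exact: equiv_under_canonical C4E _.
apply/linked_canonical/(equiv_under_linked _ GH) => F F'.
by apply: (vertex_move_linked (j := 1)) => T t; rewrite C4E.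
Qed.
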